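(* Let $\mathcal R_P$ and $\widetilde{\mathcal R}_P$ denote the residual-moment maps on the macro-patch $P$ formed with coefficients $(A,\eta)$ and $(A_m,\eta_m)$, respectively. Then for all $v\in S_p^1(P)$ and $\psi\in Y_r(P)$, $$|\langle(\mathcal R_P-\widetilde{\mathcal R}_P)v,\psi\rangle|\le\mathfrak E_P(v,\psi),$$ where, with $\delta A_K=(A-A_m)|_K$ and $\delta\eta_K=(\eta-\eta_m)|_K$, $$\mathfrak E_P(v,\psi)=\sum_{K\subset P}\Big\{\|\delta A_K\|_{L^\infty(K)}\|\nabla v\|_{L^2(K)}\|\nabla\psi\|_{L^2(K)}+\|\delta A_K\|_{L^\infty(\partial K)}\|\nabla v\|_{L^2(\partial K)}\|\psi\|_{L^2(\partial K)}+\kappa^2\|\delta\eta_K\|_{L^\infty(K)}\|v\|_{L^2(K)}\|\psi\|_{L^2(K)}\Big\}.$$ If the source $f$ is also replaced by a projected source $f_m$, then with $\delta f_K=(f-f_m)|_K$ its moment perturbation satisfies $$|(f-f_m,\psi)_P|\le\sum_{K\subset P}\|\delta f_K\|_{L^2(K)}\|\psi\|_{L^2(K)}.$$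
   Context: $P$ is a polygonal macro-patch with a conforming triangulation into triangles $K\subset P$; $p\ge2$, $r=p-2$; $\kappa>0$. $S_p^1(P)$ is the space of $C^1(P)$ functions that are polynomials of degree $\le p$ on each triangle; $Y_r(P)=\prod_{K\subset P}\mathbb P_r(K)$ is the broken polynomial space. $A$ is a smooth symmetric uniformly positive definite real $2\times2$ matrix field, $\eta\ge\eta_0>0$ a smooth scalar function, $f\in L^2(P)$; $A_m$, $\eta_m$ and $f_m$ are trianglewise polynomial approximations of $A$, $\eta$, $f$. For a coefficient pair $(B,\beta)$ the residual-moment map is $$\langle\mathcal R_P^{(B,\beta)}(v),\psi\rangle=\sum_{K\subset P}\Big[(B\nabla v,\nabla\psi)_K-\langle n_K\cdot B\nabla v,\psi\rangle_{\partial K}-\kappa^2(\beta v,\psi)_K\Big],$$ with $n_K$ the outward unit normal to $K$ and $(\cdot,\cdot)_K$, $\langle\cdot,\cdot\rangle_{\partial K}$ the (complex) $L^2$ inner products; on $\partial K$ traces from inside $K$ are used. $\mathcal R_P=\mathcal R_P^{(A,\eta)}$ and $\widetilde{\mathcal R}_P=\mathcal R_P^{(A_m,\eta_m)}$. $L^\infty$ norms of matrix fields use the pointwise spectral norm. *)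

(* Defs.v *)
From HB Require Import structures.
From mathcomp Require Import all_boot all_order all_algebra.
From mathcomp Require Import -(notations) mpoly.
From mathcomp Require Import all_classical all_reals all_analysis.
From mathcomp Require Import complex.

Set Implicit Arguments.
Unset Strict Implicit.
Unset Printing Implicit Defensive.

Import Order.TTheory GRing.Theory Num.Theory.
Import numFieldNormedType.Exports.

Local Open Scope classical_set_scope.
Local Open Scope ring_scope.

Section Geometry.
Context {R : realType}.

Definition edist (a b : R * R) : R :=
  Num.sqrt ((b.1 - a.1) ^+ 2 + (b.2 - a.2) ^+ 2).

Definition cross (a b c : R * R) : R :=
  (b.1 - a.1) * (c.2 - a.2) - (b.2 - a.2) * (c.1 - a.1).

Record triangle := Triangle {
  vertex :> 'I_3 -> R * R;
  nondegenerate : cross (vertex 0) (vertex 1) (vertex 2%:R) != 0 }.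

(* Convex hull of the vertices of [K] indexed by [I]: the empty set, a vertex,
   a closed edge or the closed triangle according to #|I|. *)
Definition face (K : triangle) (I : {set 'I_3}) : set (R * R) :=
  [set x | exists l : 'I_3 -> R,
    [/\ forall i, 0 <= l i, forall i, i \notin I -> l i = 0, \sum_i l i = 1,
        x.1 = \sum_i l i * (K i).1 & x.2 = \sum_i l i * (K i).2]].

Definition triangle_set (K : triangle) : set (R * R) := face K [set: 'I_3].

Record triangulation := Triangulation {
  ntri : nat;
  tri :> 'I_ntri -> triangle;
  ntri_gt0 : (0 < ntri)%N;
  conforming : forall i j : 'I_ntri, i != j ->
    exists I J : {set 'I_3},
      [/\ I != [set: 'I_3]%SET, J != [set: 'I_3]%SET,
          triangle_set (tri i) `&` triangle_set (tri j) = face (tri i) I &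
          triangle_set (tri i) `&` triangle_set (tri j) = face (tri j) J] }.

Definition patch_set (T : triangulation) : set (R * R) :=
  [set x | exists K, triangle_set (T K) x].

(* Edge [i] is the one opposite to vertex [i]; indices are modulo 3. *)
Definition edge (K : triangle) (i : 'I_3) : set (R * R) := face K [set~ i].
Definition edge_start (K : triangle) (i : 'I_3) : R * R := K (i + 1).
Definition edge_end (K : triangle) (i : 'I_3) : R * R := K (i + 2%:R).
Definition edge_length (K : triangle) (i : 'I_3) : R :=
  edist (edge_start K i) (edge_end K i).

(* A unit normal to edge [i], then oriented away from vertex [i]. *)
Definition edge_perp (K : triangle) (i : 'I_3) : R * R :=
  (((edge_end K i).2 - (edge_start K i).2) / edge_length K i,
   ((edge_start K i).1 - (edge_end K i).1) / edge_length K i).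
Definition outward_normal (K : triangle) (i : 'I_3) : R * R :=
  let w := edge_perp K i in
  let s := Num.sg (w.1 * ((edge_start K i).1 - (K i).1)
                 + w.2 * ((edge_start K i).2 - (K i).2)) in
  (s * w.1, s * w.2).

(* [R * R] with the sigma-algebra on which Lebesgue measure lives. *)
Definition plane := (measurableTypeR R * measurableTypeR R)%type.

Definition area : {measure set plane -> \bar R} :=
  (lebesgue_measure \x lebesgue_measure)%E.

Definition edge_param (K : triangle) (i : 'I_3) (t : measurableTypeR R) : plane :=
  ((1 - t) * (edge_start K i).1 + t * (edge_end K i).1,
   (1 - t) * (edge_start K i).2 + t * (edge_end K i).2).

Lemma measurable_edge_param K i : measurable_fun setT (edge_param K i).
Proof.
by apply/measurable_fun_pair => /=; apply: measurable_realfun.measurable_funD;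
  apply: measurable_realfun.measurable_funM => //; apply: measurable_realfun.measurable_funB.
Qed.

Lemma edge_length_ge0 K i : 0 <= edge_length K i.
Proof. exact: sqrtr_ge0. Qed.

Lemma measurable_unit_itv : measurable (`[0, 1]%classic : set (measurableTypeR R)).
Proof. exact: measurable_itv. Qed.

(* The instance is given by name because the measurability of [edge_param]
   cannot be inferred by unification. *)
Definition edge_measure (K : triangle) (i : 'I_3) : {measure set plane -> \bar R} :=
  mscale (NngNum (edge_length_ge0 K i))
    (measure_function_pushforward__canonical__measure_function_Measure
       (mrestr lebesgue_measure measurable_unit_itv)
       (@measurable_edge_param K i)).

Definition boundary_measure (K : triangle) : {measure set plane -> \bar R} :=
  msum (fun k => edge_measure K (inord k)) 3.

(* The partial derivatives in the interior of [D] extend to functions that are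
   of class C^(k-1) up to the boundary of [D]. *)
Fixpoint Ck (k : nat) (D : set (R * R)) (u : R * R -> R) : Prop :=
  {within D, continuous u} /\
  if k is k'.+1 then
    exists u1 u2 : R * R -> R,
      [/\ Ck k' D u1, Ck k' D u2 &
          forall x, interior D x ->
            [/\ differentiable u x, 'D_((1, 0) : R * R) u x = u1 x &
                'D_((0, 1) : R * R) u x = u2 x]]
  else True.

Definition smooth (D : set (R * R)) (u : R * R -> R) : Prop :=
  forall k, Ck k D u.

Notation rpoly := (mpoly 2 R).
Notation cpoly := (mpoly 2 R[i]).

Definition coord2 (x : R * R) (i : 'I_2) : R := if i == 0 then x.1 else x.2.

Definition evalr (q : rpoly) (x : R * R) : R := meval (coord2 x) q.

Definition evalc (q : cpoly) (x : R * R) : R[i] :=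
  meval (fun i => (coord2 x i)%:C%C) q.

Definition gradc (q : cpoly) (x : R * R) : 'cV[R[i]]_2 :=
  \col_i evalc (mderiv i q) x.

(* [msize q] is one more than the total degree of [q], and 0 for [q = 0]. *)
Definition deg_le (d : nat) (q : cpoly) : Prop := (msize q <= d.+1)%N.

Definition broken_poly (T : triangulation) := 'I_(ntri T) -> cpoly.

Definition Yspace (T : triangulation) (r : nat) : set (broken_poly T) :=
  [set psi | forall K, deg_le r (psi K)].

Definition S1space (T : triangulation) (p : nat) : set (R * R -> R[i]) :=
  [set v | [/\ Ck 1 (patch_set T) (fun x => complex.Re (v x)),
               Ck 1 (patch_set T) (fun x => complex.Im (v x)) &
               forall K, exists2 q : cpoly, deg_le p q &
                 forall x, triangle_set (T K) x -> v x = evalc q x]].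

(* The polynomial with which [v] coincides on [K] (it is unique, as [K] has
   interior points); 0 if there is none. *)
Definition piece (K : triangle) (v : R * R -> R[i]) : cpoly :=
  xget 0 [set q : cpoly | forall x, triangle_set K x -> v x = evalc q x].

(* Gradient of the restriction of [v] to [K], including its trace on the
   boundary of [K] from inside [K]. *)
Definition gradK (K : triangle) (v : R * R -> R[i]) : R * R -> 'cV[R[i]]_2 :=
  gradc (piece K v).

Definition normcv (z : 'cV[R[i]]_2) : R :=
  Num.sqrt (\sum_i Normc.normc (z i 0) ^+ 2).

Definition normrv (x : 'cV[R]_2) : R := Num.sqrt (\sum_i x i 0 ^+ 2).

Definition spectral_norm (M : 'M[R]_2) : R :=
  sup [set normrv (M *m x) | x in [set x : 'cV[R]_2 | normrv x <= 1]].

Definition norm_on (p : \bar R) (D : set (R * R)) (g : R * R -> R) : \bar R :=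
  Lnorm area p (fun x => (g x * \1_D x)%:E).

Definition norm_boundary (p : \bar R) (K : triangle) (g : R * R -> R) : \bar R :=
  Lnorm (boundary_measure K) p (fun x => (g x)%:E).

Definition square_integrable (D : set (R * R)) (f : R * R -> R[i]) : Prop :=
  [/\ measurable_fun (D : set plane) (fun x => complex.Re (f x)),
      measurable_fun (D : set plane) (fun x => complex.Im (f x)) &
      (norm_on 2%:E D (fun x => Normc.normc (f x)) < +oo)%E].

Definition cintegral (mu : {measure set plane -> \bar R}) (D : set (R * R))
    (w : R * R -> R[i]) : R[i] :=
  Complex (\int[mu]_(x in D) complex.Re (w x)) (\int[mu]_(x in D) complex.Im (w x)).

Definition inner_prod (mu : {measure set plane -> \bar R}) (D : set (R * R))
    (g h : R * R -> R[i]) : R[i] :=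
  cintegral mu D (fun x => g x * conjc (h x)).

Definition inner_prodv (mu : {measure set plane -> \bar R}) (D : set (R * R))
    (g h : R * R -> 'cV[R[i]]_2) : R[i] :=
  cintegral mu D (fun x => \sum_i g x i 0 * conjc (h x i 0)).

Definition cmx (M : 'M[R]_2) : 'M[R[i]]_2 := map_mx (fun a => a%:C%C) M.

Definition flux (K : triangle) (i : 'I_3) (z : 'cV[R[i]]_2) : R[i] :=
  ((outward_normal K i).1)%:C%C * z 0 0 + ((outward_normal K i).2)%:C%C * z 1 0.

Section Residual.
Variables (T : triangulation) (kappa : R).

Definition residual (B : 'I_(ntri T) -> R * R -> 'M[R]_2)
    (beta : 'I_(ntri T) -> R * R -> R)
    (v : R * R -> R[i]) (psi : broken_poly T) : R[i] :=
  \sum_K (inner_prodv area (triangle_set (T K))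
            (fun x => cmx (B K x) *m gradK (T K) v x) (gradc (psi K))
        - \sum_i inner_prod (edge_measure (T K) i) (edge (T K) i)
            (fun x => flux (T K) i (cmx (B K x) *m gradK (T K) v x)) (evalc (psi K))
        - (kappa ^+ 2)%:C%C * inner_prod area (triangle_set (T K))
            (fun x => (beta K x)%:C%C * v x) (evalc (psi K))).

Definition consistency_bound (B B' : 'I_(ntri T) -> R * R -> 'M[R]_2)
    (beta beta' : 'I_(ntri T) -> R * R -> R)
    (v : R * R -> R[i]) (psi : broken_poly T) : \bar R :=
  (\sum_(K < ntri T)
     (norm_on +oo (triangle_set (T K)) (fun x => spectral_norm (B K x - B' K x)%R)
        * norm_on 2%:E (triangle_set (T K)) (fun x => normcv (gradK (T K) v x))
        * norm_on 2%:E (triangle_set (T K)) (fun x => normcv (gradc (psi K) x))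
    + norm_boundary +oo (T K) (fun x => spectral_norm (B K x - B' K x)%R)
        * norm_boundary 2%:E (T K) (fun x => normcv (gradK (T K) v x))
        * norm_boundary 2%:E (T K) (fun x => Normc.normc (evalc (psi K) x))
    + (kappa ^+ 2)%:E
        * norm_on +oo (triangle_set (T K)) (fun x => `|beta K x - beta' K x|%R)
        * norm_on 2%:E (triangle_set (T K)) (fun x => Normc.normc (v x))
        * norm_on 2%:E (triangle_set (T K))
            (fun x => Normc.normc (evalc (psi K) x))))%E.

(* A function on the patch representing the class of a broken polynomial: the
   triangles overlap only in edges, which form a null set. *)
Definition broken_fun (psi : broken_poly T) (x : R * R) : R[i] :=
  if [pick K | `[< triangle_set (T K) x >]] is Some K then evalc (psi K) x else 0.

End Residual.

Definition evalr_mx (M : 'M[rpoly]_2) (x : R * R) : 'M[R]_2 :=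
  \matrix_(i, j) evalr (M i j) x.

Definition uniformly_posdef (D : set (R * R)) (A : R * R -> 'M[R]_2) : Prop :=
  exists2 a : R, 0 < a &
    forall x, D x -> forall xi : 'cV[R]_2,
      a * normrv xi ^+ 2 <= (xi^T *m A x *m xi) 0 0.

End Geometry.

Arguments triangle : clear implicits.
Arguments triangulation : clear implicits.
Notation rpoly R := (mpoly 2 R).

(* Main.v *)
Require Import Defs.
From HB Require Import structures.
From mathcomp Require Import all_boot all_order all_algebra.
From mathcomp Require Import -(notations) mpoly.
From mathcomp Require Import all_classical all_reals all_analysis.
From mathcomp Require Import complex.
From mathcomp Require Import ring lra.

Set Implicit Arguments.
Unset Strict Implicit.
Unset Printing Implicit Defensive.

Import Order.TTheory GRing.Theory Num.Theory.
Import numFieldNormedType.Exports.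

Local Open Scope classical_set_scope.
Local Open Scope ring_scope.

(* For coefficients with difference dA, d eta, the residuals differ by integrals
   over K and its edges of dA grad v . grad psi, n . dA grad v psi and
   d eta v psi, since all integrands are bounded and measurable on sets of
   finite measure.  Each integral is bounded by |z| <= \int |w|, by
   |dA z| <= |dA|_2 |z| pointwise, by taking out the essential supremum, and by
   the Cauchy-Schwarz inequality; the three edges are summed before
   Cauchy-Schwarz is applied, which yields norms over the whole boundary.  For
   the source, |(f - f_m) psi| on the patch is at most the sum over K of its
   restrictions to the triangles containing the point, so overlaps of triangles
   need no discussion. *)

(** * Borel sets of the plane and continuous functions on subsets of it *)

Section PlaneTopology.
Context {R : realType}.

(** The measurable sets of [plane] come from a product sigma-algebra, so open sets are written as
    countable unions of rational boxes. *)
Lemma open_measurable_plane (U : set (R * R)) :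
  open U -> measurable (U : set (plane (R := R))).
Proof.
move=> oU.
pose box (q : rat * rat * rat) : set (R * R) :=
  `]ratr q.1.1 - ratr q.2, ratr q.1.1 + ratr q.2[%classic `*`
  `]ratr q.1.2 - ratr q.2, ratr q.1.2 + ratr q.2[%classic.
(* Boxes that leave [U] are replaced by [set0], so that the union runs over the whole countable type
   of rational triples. *)
pose F q := if `[< box q `<=` U >] then box q else set0.
have -> : U = \bigcup_q F q.
  apply/seteqP; split => [[x y] Uxy|x [q _]]; last first.
    by rewrite /F; case: asboolP => // bU; exact: bU.
  have : nbhs (x, y) U by apply: open_nbhs_nbhs.
  move=> /nbhs_ballP[e /= e0 eU].
  (* The centre [(a, b)] is within e/4 of the point in each coordinate and e/4 < r < e/2: the box
     contains the point, and its points are within r + e/4 < e of it. *)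
  have e4 : 0 < e / 4 :> R by rewrite divr_gt0.
  have /rat_in_itvoo[r] : e / 4 < e / 2 by lra.
  rewrite in_itv/= => /andP[r1 r2].
  have /rat_in_itvoo[a] : x - e / 4 < x + e / 4 by lra.
  rewrite in_itv/= => /andP[a1 a2].
  have /rat_in_itvoo[b] : y - e / 4 < y + e / 4 by lra.
  rewrite in_itv/= => /andP[b1 b2].
  exists (a, b, r) => //; rewrite /F; case: asboolP => [_|]; last first.
    move=> nU; exfalso; apply: nU => -[u w] [/=]; rewrite !in_itv/=.
    move=> /andP[u1 u2] /andP[w1 w2]; apply: eU; split; rewrite /ball/= ltr_norml; apply/andP; split; lra.
  by split; rewrite /= in_itv/=; apply/andP; split; lra.
apply: countable_bigcupT_measurable => [|q]; first exact: countableP.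
rewrite /F; case: asboolP => // _.
by apply: measurableX; exact: measurable_itv.
Qed.

Lemma closed_measurable_plane (U : set (R * R)) :
  closed U -> measurable (U : set (plane (R := R))).
Proof. by move/closed_openC/open_measurable_plane/measurableC; rewrite setCK. Qed.

(** Open intervals generate the Borel sets of the line, and the preimage of one is the trace on [D]
    of an open set of the plane. *)
Lemma within_continuous_measurable_plane (D : set (R * R)) (f : R * R -> R) :
  measurable (D : set (plane (R := R))) -> {within D, continuous f} ->
  measurable_fun (D : set (plane (R := R))) f.
Proof.
move=> mD /continuousP cf.
apply: (measurability _ (measurable_realfun.RGenOpens.measurableE R)).
move=> _ [_ [a [b ->] <-]].
have oab : open (`]a, b[%classic : set R) by exact: interval_open.
have /open_subspaceP[V oV VD] := cf _ oab.
rewrite setIC -VD; apply: measurableI => //; exact: open_measurable_plane.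
Qed.

Lemma within_continuous_bounded (D : set (R * R)) (f : R * R -> R) :
  compact D -> {within D, continuous f} ->
  exists C, forall x, D x -> `|f x| <= C.
Proof.
move=> cD cf.
have [C [_ CP]] := compact_bounded (continuous_compact cf cD).
(* [compact_bounded] makes every number strictly above [C] a bound, hence the shift by 1. *)
exists (C + 1) => x Dx; apply: CP; [by rewrite ltrDl|by exists x].
Qed.

End PlaneTopology.

(** * Compactness, measurability and finite measure of triangles and edges *)

Section Faces.
Context {R : realType}.

(** A face is the image under a linear map of its set of barycentric coordinates, a closed subset of
    a compact box. *)
Lemma face_compact (K : triangle R) (I : {set 'I_3}) : compact (face K I).
Proof.
pose S : set 'rV[R]_3 :=
  [set l | forall i, (if i \in I then `[0, 1]%classic else [set 0]) (l ord0 i)].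
(* Used with [c] constantly 1 for the constraint on the sum of the weights, and with the vertex
   coordinates for the map [h]. *)
have csum (c : 'I_3 -> R) : continuous (fun l : 'rV[R]_3 => \sum_i l ord0 i * c i).
  apply: continuous_big => [|i _]; first exact: add_continuous.
  have ci : continuous (fun l : 'rV[R]_3 => l ord0 i).
    exact: (@coord_continuous R 1 3 ord0 i).
  by move=> l; exact: (cvgM (ci l) (cvg_cst _)).
have cS : compact (S `&` [set l : 'rV[R]_3 | \sum_i l ord0 i * 1 = 1]).
  have cS0 : compact S.
    apply: (@rV_compact R 3 (fun i => if i \in I then _ else _)) => i.
    by case: ifP => _; [exact: segment_compact|exact: compact_set1].
  apply: (compact_closedI cS0).
  apply: (@preimage_closed _ _ (fun l : 'rV[R]_3 => \sum_i l ord0 i * 1) [set 1]).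
    by move=> l _; exact: csum.
  exact: closed_eq.
pose h (l : 'rV[R]_3) : R * R := (\sum_i l ord0 i * (K i).1, \sum_i l ord0 i * (K i).2).
rewrite (_ : face K I = h @` (S `&` [set l | \sum_i l ord0 i * 1 = 1])).
  have ch : continuous h by move=> l; exact: (cvg_pair (csum _ l) (csum _ l)).
  exact: (continuous_compact (continuous_subspaceT ch) cS).
apply/seteqP; split => [[x y] [l [l0 lI l1 /= xE yE]]|_ [l [Sl l1] <-]].
  exists (\row_i l i); last first.
    by rewrite xE yE /h; congr pair; apply: eq_bigr => i _; rewrite mxE.
  split; last by rewrite /= -[RHS]l1; apply: eq_bigr => i _; rewrite mxE mulr1.
  move=> i; rewrite mxE; case: ifPn => [_|/lI//].
  rewrite /= in_itv/= l0/= -l1 (bigD1 i)//= lerDl.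
  by apply: sumr_ge0 => j _; exact: l0.
exists (fun i => l ord0 i); split => //.
- move=> i; have := Sl i; case: ifP => _ /=; last by move=> ->.
  by rewrite in_itv/= => /andP[].
- by move=> i iI; have := Sl i; rewrite (negbTE iI).
- by rewrite -[RHS]l1; apply: eq_bigr => i _; rewrite mulr1.
Qed.

Lemma compact_measurable_plane (D : set (R * R)) :
  compact D -> measurable (D : set (plane (R := R))).
Proof.
move=> cD; apply: closed_measurable_plane; apply: (compact_closed _ cD).
exact: (@norm_hausdorff R (R * R)%type).
Qed.

Lemma face_measurable (K : triangle R) (I : {set 'I_3}) :
  measurable (face K I : set (plane (R := R))).
Proof. exact: (compact_measurable_plane (@face_compact K I)). Qed.

Lemma patch_set_bigcup (T : triangulation R) :
  patch_set T = \bigcup_(K in [set: 'I_(ntri T)]) triangle_set (T K).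
Proof. by apply/seteqP; split => x [K]; exists K. Qed.

Lemma patch_measurable (T : triangulation R) :
  measurable (patch_set T : set (plane (R := R))).
Proof.
rewrite patch_set_bigcup; apply: fin_bigcup_measurable => // K _.
exact: face_measurable.
Qed.

Lemma compact_plane_bounded (D : set (R * R)) : compact D ->
  exists r, forall x, D x -> `|x.1| <= r /\ `|x.2| <= r.
Proof.
move=> /(@compact_bounded _ (R * R)%type)[C [_ CP]].
exists (C + 1) => x Dx; apply/andP; rewrite -ge_max.
by apply: (CP (C + 1)) => //; rewrite ltrDl.
Qed.

(** A compact set lies in a square, whose area is a product of two finite lengths. *)
Lemma area_compact_lty (D : set (R * R)) : compact D -> (area D < +oo)%E.
Proof.
move=> cD; have [r rP] := compact_plane_bounded cD.
pose B : set (plane (R := R)) := `[- r, r]%classic `*` `[- r, r]%classic.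
have mB : measurable B by apply: measurableX; exact: measurable_itv.
apply: (@le_lt_trans _ _ (area B)).
  apply: le_measure; rewrite ?inE//.
    exact: compact_measurable_plane.
  by move=> x /rP[x1 x2]; split; rewrite /= in_itv/= -ler_norml.
have -> : area B = (lebesgue_measure (`[(- r)%R, r]%classic : set R) *
                    lebesgue_measure (`[(- r)%R, r]%classic : set R))%E.
  by apply: product_measure1E; exact: measurable_itv.
by rewrite lte_mul_pinfty//= lebesgue_measure_itv/=; case: ifP => //; rewrite ?ltry.
Qed.

(** Up to the factor [edge_length K i], the value is the Lebesgue measure of a subset of the unit
    interval. *)
Lemma edge_measure_lty (K : triangle R) (i : 'I_3) (D : set (plane (R := R))) :
  measurable D -> (edge_measure K i D < +oo)%E.
Proof.
move=> mD; rewrite /edge_measure /mscale/= /pushforward /mrestr.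
apply: lte_mul_pinfty => //.
apply: le_lt_trans (_ : (lebesgue_measure (`[0%R, 1%R]%classic : set R) < +oo)%E); last first.
  by rewrite lebesgue_measure_itv/= lte_fin ltr01 ltry.
apply: le_measure; rewrite ?inE//.
apply: measurableI => //; rewrite -[X in measurable X]setTI.
exact: measurable_edge_param.
Qed.

End Faces.

(** * Pointwise inequalities for complex vectors, real matrices and normals *)

Section ComplexVectors.
Context {R : realType}.
Local Notation normc := (@Normc.normc R).
Implicit Types (z w : R[i]) (a b c d : R).

Lemma normc_ge0 z : 0 <= normc z.
Proof. by case: z => a b; exact: sqrtr_ge0. Qed.

Lemma normc_sqrE z : normc z ^+ 2 = complex.Re z ^+ 2 + complex.Im z ^+ 2.
Proof. by case: z => a b; rewrite sqr_sqrtr ?addr_ge0 ?sqr_ge0. Qed.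

Lemma normc_real a : normc a%:C%C = `|a|.
Proof. by rewrite /= expr0n/= addr0 sqrtr_sqr. Qed.

Lemma normc_conj z : normc (conjc z) = normc z.
Proof. by case: z => a b; rewrite /= sqrrN. Qed.

Lemma normrRe_le z : `|complex.Re z| <= normc z.
Proof.
by case: z => a b; rewrite /= -sqrtr_sqr ler_wsqrtr// lerDl sqr_ge0.
Qed.

Lemma normrIm_le z : `|complex.Im z| <= normc z.
Proof.
by case: z => a b; rewrite /= -sqrtr_sqr ler_wsqrtr// lerDr sqr_ge0.
Qed.

Lemma normcD_le z w : normc (z + w) <= normc z + normc w.
Proof. exact: le_normcD. Qed.

Lemma normcB_le z w : normc (z - w) <= normc z + normc w.
Proof. by rewrite -(normcN w) normcD_le. Qed.

Lemma normc_sum_le (I : Type) (s : seq I) (F : I -> R[i]) :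
  normc (\sum_(i <- s) F i) <= \sum_(i <- s) normc (F i).
Proof.
elim/big_rec2: _ => [|i x y _ xy]; first by rewrite Normc.normc0.
by apply: (le_trans (normcD_le _ _)); rewrite lerD2l.
Qed.

(** By Lagrange's identity, the difference of the squares of the two sides is (ad - cb)^2. *)
Lemma cauchy_schwarz2 a b c d :
  a * b + c * d <= Num.sqrt (a ^+ 2 + c ^+ 2) * Num.sqrt (b ^+ 2 + d ^+ 2).
Proof.
rewrite -sqrtrM ?addr_ge0 ?sqr_ge0// (le_trans (ler_norm _))//.
rewrite -sqrtr_sqr ler_wsqrtr// -subr_ge0.
have -> : (a ^+ 2 + c ^+ 2) * (b ^+ 2 + d ^+ 2) - (a * b + c * d) ^+ 2 =
  (a * d - c * b) ^+ 2 by ring.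
exact: sqr_ge0.
Qed.

(** Splits a complex vector into two real ones, on which a real matrix acts separately. *)
Lemma sqr_normcv (z : 'cV[R[i]]_2) :
  normcv z ^+ 2 = normrv (\col_i complex.Re (z i 0)) ^+ 2 +
                  normrv (\col_i complex.Im (z i 0)) ^+ 2.
Proof.
rewrite !sqr_sqrtr ?sumr_ge0// => [|i _|i _|i _]; rewrite ?sqr_ge0//.
by rewrite -big_split; apply: eq_bigr => i _; rewrite !mxE normc_sqrE.
Qed.

Lemma normc_inner_le (z w : 'cV[R[i]]_2) :
  normc (\sum_i z i 0 * conjc (w i 0)) <= normcv z * normcv w.
Proof.
apply: (le_trans (normc_sum_le _ _)); rewrite /normcv !big_ord_recl !big_ord0 !addr0.
by rewrite !Normc.normcM !normc_conj cauchy_schwarz2.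
Qed.

(** A nonzero [x] is scaled to the unit sphere, where the supremum applies; this requires the
    supremum to be over a nonempty bounded set. *)
Lemma normrv_mul_le_spectral (M : 'M[R]_2) (x : 'cV[R]_2) :
  normrv (M *m x) <= spectral_norm M * normrv x.
Proof.
have nZ a (y : 'cV[R]_2) : 0 <= a -> normrv (a *: y) = a * normrv y.
  move=> a0; rewrite /normrv; under eq_bigr do rewrite mxE exprMn.
  by rewrite -mulr_sumr sqrtrM ?sqr_ge0// sqrtr_sqr ger0_norm.
have le_coord (y : 'cV[R]_2) i : `|y i 0| <= normrv y.
  rewrite -sqrtr_sqr ler_wsqrtr// (bigD1 i)//= lerDl.
  by apply: sumr_ge0 => j _; exact: sqr_ge0.
have n_le (y : 'cV[R]_2) : normrv y <= `|y 0 0| + `|y 1 0|.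
  rewrite -[leRHS]ger0_norm ?addr_ge0// -sqrtr_sqr ler_wsqrtr//.
  rewrite /normrv !big_ord_recl big_ord0 addr0 (_ : lift _ _ = 1); last exact/val_inj.
  rewrite -(real_normK (num_real (y 0 0))) -(real_normK (num_real (y 1 0))).
  have := normr_ge0 (y 0 0); have := normr_ge0 (y 1 0); nra.
have ub : has_sup [set normrv (M *m x) | x in [set x : 'cV[R]_2 | normrv x <= 1]].
  split; first by exists (normrv (M *m 0)); exists 0 => //=;
    rewrite /normrv big1 ?sqrtr0// => i _; rewrite mxE expr0n.
  (* Coordinates of a vector in the unit ball are at most 1 in modulus, so the sum of the moduli of
     all entries of [M] is an upper bound. *)
  exists (\sum_i `|M 0 i| + \sum_i `|M 1 i|) => _ [y /= y1 <-].
  apply: (le_trans (n_le _)); rewrite !mxE; apply: lerD;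
    apply: (le_trans (ler_norm_sum _ _ _)); apply: ler_sum => i _;
    by rewrite normrM ler_piMr// (le_trans (le_coord _ _)).
have [x0|x0] := eqVneq (normrv x) 0.
  have -> : x = 0.
    apply/matrixP => i j; rewrite (ord1 j) mxE; apply/eqP.
    by rewrite -normr_le0 -x0 le_coord.
  rewrite mulmx0; have := nZ 0 0 (lexx _); rewrite scale0r mul0r => ->.
  by rewrite mulr0.
have xp : 0 < normrv x by rewrite lt_neqAle eq_sym x0 sqrtr_ge0.
rewrite -ler_pdivrMr// mulrC -nZ ?invr_ge0 ?(ltW xp)// scalemxAr.
apply: (sup_upper_bound ub); exists ((normrv x)^-1 *: x) => //=.
by rewrite nZ ?invr_ge0 ?(ltW xp)// mulVf.
Qed.

(** The previous inequality at one nonzero vector forces the sign. *)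
Lemma spectral_norm_ge0 (M : 'M[R]_2) : 0 <= spectral_norm M.
Proof.
pose e : 'cV[R]_2 := const_mx 1.
have e0 : 0 < normrv e.
  by rewrite sqrtr_gt0 !big_ord_recl big_ord0 !mxE expr1n addr0 addr_gt0.
rewrite -(pmulr_lge0 _ e0); apply: le_trans (normrv_mul_le_spectral M e).
exact: sqrtr_ge0.
Qed.

(** [cmx M] is real, so it commutes with taking real and imaginary parts; the real inequality is
    applied to each part and the squares are added. *)
Lemma normcv_mul_le_spectral (M : 'M[R]_2) (z : 'cV[R[i]]_2) :
  normcv (cmx M *m z) <= spectral_norm M * normcv z.
Proof.
have s0 := spectral_norm_ge0 M.
rewrite -(@ler_pXn2r _ 2%N)// ?nnegrE ?mulr_ge0 ?sqrtr_ge0//.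
rewrite exprMn !sqr_normcv mulrDr -!exprMn.
have reM : \col_i complex.Re ((cmx M *m z) i 0) = M *m \col_i complex.Re (z i 0).
  apply/matrixP => i j; rewrite !mxE raddf_sum; apply: eq_bigr => k _.
  by rewrite !mxE; case: (z k 0) => u v /=; rewrite mul0r subr0.
have imM : \col_i complex.Im ((cmx M *m z) i 0) = M *m \col_i complex.Im (z i 0).
  apply/matrixP => i j; rewrite !mxE raddf_sum; apply: eq_bigr => k _.
  by rewrite !mxE; case: (z k 0) => u v /=; rewrite mul0r addr0.
rewrite reM imM; apply: lerD;
  by rewrite ler_pXn2r// ?nnegrE ?mulr_ge0 ?sqrtr_ge0// normrv_mul_le_spectral.
Qed.

(** The left side is s / s with s the squared length of the edge, which is 1, or 0 by the convention
    on division when s = 0. *)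
Lemma edge_perp_norm_le1 (K : triangle R) i :
  (edge_perp K i).1 ^+ 2 + (edge_perp K i).2 ^+ 2 <= 1.
Proof.
rewrite /edge_perp/= !exprMn exprVn -mulrDl /edge_length.
rewrite sqr_sqrtr ?addr_ge0 ?sqr_ge0// addrC -sqrrN opprB.
set s := _ + _; have [->|s0] := eqVneq s 0; first by rewrite mul0r ler01.
by rewrite divff.
Qed.

(** The orientation contributes the square of a sign, which is 0 or 1. *)
Lemma outward_normal_norm_le1 (K : triangle R) i :
  (outward_normal K i).1 ^+ 2 + (outward_normal K i).2 ^+ 2 <= 1.
Proof.
rewrite /outward_normal; move: (edge_perp_norm_le1 K i).
case: (edge_perp K i) => /= a b ab1; rewrite !exprMn -mulrDr.
rewrite sqr_sg; by case: (_ != 0); rewrite ?mul0r ?ler01// mul1r.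
Qed.

Lemma normc_flux_le (K : triangle R) i (z : 'cV[R[i]]_2) :
  normc (flux K i z) <= normcv z.
Proof.
apply: (le_trans (normcD_le _ _)); rewrite !Normc.normcM !normc_real.
apply: (le_trans (cauchy_schwarz2 _ _ _ _)).
rewrite -[leRHS]mul1r /normcv !big_ord_recl big_ord0 addr0 (_ : lift _ _ = 1); last exact/val_inj.
rewrite ler_wpM2r ?sqrtr_ge0// -[leRHS]sqrtr1 ler_wsqrtr// !real_normK ?num_real//.
exact: outward_normal_norm_le1.
Qed.

End ComplexVectors.

(** * Measurable, locally bounded complex functions and their closure properties *)

Section Tame.
Context {R : realType}.
Implicit Types (D : set (R * R)) (g h : R * R -> R[i]).

Definition cmeasurable D g : Prop :=
  measurable_fun (D : set (plane (R := R))) (fun x => complex.Re (g x)) /\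
  measurable_fun (D : set (plane (R := R))) (fun x => complex.Im (g x)).

(* Local boundedness makes this class contain all polynomials even for
   unbounded [D], in particular on the whole plane. *)
Definition tame D g : Prop :=
  cmeasurable D g /\
  forall r, exists C, forall x, D x -> `|x.1| <= r -> `|x.2| <= r ->
    Normc.normc (g x) <= C.

Lemma eq_cmeasurable D g h :
  (forall x, D x -> g x = h x) -> cmeasurable D g -> cmeasurable D h.
Proof.
move=> gh [mr mi]; split; [move: mr|move: mi]; apply: eq_measurable_fun => x;
  by rewrite inE => Dx; rewrite gh.
Qed.

Lemma cmeasurableD D g h :
  cmeasurable D g -> cmeasurable D h -> cmeasurable D (fun x => g x + h x).
Proof.
move=> [gr gi] [hr hi]; split.
- rewrite (_ : (fun _ => _) = (fun x => complex.Re (g x)) \+ (fun x => complex.Re (h x))).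
    exact: measurable_realfun.measurable_funD.
  by apply/funext => x /=; case: (g x) (h x) => [? ?] [].
- rewrite (_ : (fun _ => _) = (fun x => complex.Im (g x)) \+ (fun x => complex.Im (h x))).
    exact: measurable_realfun.measurable_funD.
  by apply/funext => x /=; case: (g x) (h x) => [? ?] [].
Qed.

Lemma cmeasurableM D g h :
  cmeasurable D g -> cmeasurable D h -> cmeasurable D (fun x => g x * h x).
Proof.
move=> [gr gi] [hr hi]; split.
- rewrite (_ : (fun _ => _) =
      ((fun x => complex.Re (g x)) \* (fun x => complex.Re (h x))) \-
      ((fun x => complex.Im (g x)) \* (fun x => complex.Im (h x)))).
    by apply: measurable_realfun.measurable_funB; exact: measurable_realfun.measurable_funM.
  by apply/funext => x /=; case: (g x) (h x) => [? ?] [].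
- rewrite (_ : (fun _ => _) =
      ((fun x => complex.Re (g x)) \* (fun x => complex.Im (h x))) \+
      ((fun x => complex.Im (g x)) \* (fun x => complex.Re (h x)))).
    by apply: measurable_realfun.measurable_funD; exact: measurable_realfun.measurable_funM.
  by apply/funext => x /=; case: (g x) (h x) => [? ?] [].
Qed.

Lemma cmeasurable_cst D (c : R[i]) : cmeasurable D (fun=> c).
Proof. by split; exact: measurable_cst. Qed.

Lemma cmeasurable_conj D g : cmeasurable D g -> cmeasurable D (fun x => conjc (g x)).
Proof.
move=> [gr gi]; split.
- by apply: eq_measurable_fun gr => x _; case: (g x).
- have : measurable_fun (D : set (plane (R := R))) (\- (fun x => complex.Im (g x))).
    exact: measurable_realfun.measurable_funN.
  by apply: eq_measurable_fun => x _ /=; case: (g x).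
Qed.

Lemma cmeasurable_real D (u : R * R -> R) :
  measurable_fun (D : set (plane (R := R))) u -> cmeasurable D (fun x => (u x)%:C%C).
Proof. by split => //=; exact: measurable_cst. Qed.

Lemma cmeasurable_normc D g : cmeasurable D g ->
  measurable_fun (D : set (plane (R := R))) (fun x => Normc.normc (g x)).
Proof.
move=> [gr gi].
have m2 (u : R * R -> R) : measurable_fun (D : set (plane (R := R))) u ->
    measurable_fun (D : set (plane (R := R))) (fun x => u x ^+ 2).
  by move=> mu; apply: measurable_realfun.measurable_funM.
rewrite (_ : (fun _ => _) = fun x =>
    Num.sqrt (complex.Re (g x) ^+ 2 + complex.Im (g x) ^+ 2)); last first.
  by apply/funext => x; case: (g x).
apply: (measurableT_comp (f := @Num.sqrt R)).
  by apply: measurable_realfun.continuous_measurable_fun; exact: sqrt_continuous.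
by apply: measurable_realfun.measurable_funD; exact: m2.
Qed.

Lemma eq_tame D g h : (forall x, D x -> g x = h x) -> tame D g -> tame D h.
Proof.
move=> gh [mg bg]; split; first exact: eq_cmeasurable mg.
by move=> r; have [C CP] := bg r; exists C => x Dx; rewrite -gh//; exact: CP.
Qed.

Lemma tameD D g h : tame D g -> tame D h -> tame D (fun x => g x + h x).
Proof.
move=> [mg bg] [mh bh]; split; first exact: cmeasurableD.
move=> r; have [[C CP] [C' C'P]] := (bg r, bh r); exists (C + C') => x Dx x1 x2.
by apply: (le_trans (normcD_le _ _)); apply: lerD; [exact: CP|exact: C'P].
Qed.

Lemma tameM D g h : tame D g -> tame D h -> tame D (fun x => g x * h x).
Proof.
move=> [mg bg] [mh bh]; split; first exact: cmeasurableM.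
move=> r; have [[C CP] [C' C'P]] := (bg r, bh r); exists (C * C') => x Dx x1 x2.
by rewrite Normc.normcM; apply: ler_pM; rewrite ?normc_ge0//; [exact: CP|exact: C'P].
Qed.

Lemma tame_cst D (c : R[i]) : tame D (fun=> c).
Proof. by split; [exact: cmeasurable_cst|move=> r; exists (Normc.normc c)]. Qed.

Lemma tame_conj D g : tame D g -> tame D (fun x => conjc (g x)).
Proof.
move=> [mg bg]; split; first exact: cmeasurable_conj.
by move=> r; have [C CP] := bg r; exists C => x; rewrite normc_conj; exact: CP.
Qed.

Lemma tame_sum D (I : Type) (s : seq I) (G : I -> R * R -> R[i]) :
  (forall i, tame D (G i)) -> tame D (fun x => \sum_(i <- s) G i x).
Proof.
move=> tG; elim: s => [|i s IH].
  by apply: (@eq_tame D (fun=> 0)) (tame_cst D 0) => x _; rewrite big_nil.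
by apply: eq_tame (tameD (tG i) IH) => x _; rewrite big_cons.
Qed.

Lemma tame_prod D (I : Type) (s : seq I) (G : I -> R * R -> R[i]) :
  (forall i, tame D (G i)) -> tame D (fun x => \prod_(i <- s) G i x).
Proof.
move=> tG; elim: s => [|i s IH].
  by apply: (@eq_tame D (fun=> 1)) (tame_cst D 1) => x _; rewrite big_nil.
by apply: eq_tame (tameM (tG i) IH) => x _; rewrite big_cons.
Qed.

Lemma tameX D g n : tame D g -> tame D (fun x => g x ^+ n).
Proof.
move=> tg; elim: n => [|n IH]; first exact: tame_cst.
by apply: eq_tame (tameM tg IH) => x _; rewrite exprS.
Qed.

Lemma tame_subset D D' g : D' `<=` D -> measurable (D : set (plane (R := R))) ->
  tame D g -> tame D' g.
Proof.
move=> D'D mD [[mr mi] bg]; split.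
  by split; [apply: measurable_funS mr|apply: measurable_funS mi].
by move=> r; have [C CP] := bg r; exists C => x /D'D; exact: CP.
Qed.

Lemma tame_coord D (i : 'I_2) : tame D (fun x => (coord2 x i)%:C%C).
Proof.
split.
  apply: cmeasurable_real; rewrite /coord2; case: (i == 0).
    apply: (@measurable_funS _ _ _ _ setT) => //; exact: measurable_fst.
  apply: (@measurable_funS _ _ _ _ setT) => //; exact: measurable_snd.
by move=> r; exists r => x _ x1 x2; rewrite normc_real /coord2; case: ifP.
Qed.

(** A polynomial is a finite sum of constants times products of powers of coordinates, each of which
    is tame. *)
Lemma tame_evalc D (q : mpoly 2 R[i]) : tame D (evalc q).
Proof.
suff : tame D (fun x => \sum_(m <- msupp q)
    mcoeff m q * \prod_(i < 2) (coord2 x i)%:C%C ^+ m i).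
  by apply: eq_tame => x _; rewrite /evalc mevalE.
apply: tame_sum => m; apply: tameM; first exact: tame_cst.
apply: tame_prod => i; apply: tameX; exact: tame_coord.
Qed.

Lemma tame_evalr D (q : mpoly 2 R) : tame D (fun x => (evalr q x)%:C%C).
Proof.
suff : tame D (fun x => \sum_(m <- msupp q)
    (mcoeff m q)%:C%C * \prod_(i < 2) (coord2 x i)%:C%C ^+ m i).
  apply: eq_tame => x _; rewrite /evalr mevalE rmorph_sum/=; apply: eq_bigr => m _.
  by rewrite rmorphM rmorph_prod/=; congr (_ * _); apply: eq_bigr => i _; rewrite rmorphXn.
apply: tame_sum => m; apply: tameM; first exact: tame_cst.
apply: tame_prod => i; apply: tameX; exact: tame_coord.
Qed.

Lemma tame_gradc D (q : mpoly 2 R[i]) i j : tame D (fun x => gradc q x i j).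
Proof. by apply: eq_tame (tame_evalc D (mderiv i q)) => x _; rewrite mxE. Qed.

Lemma tame_continuous D (u : R * R -> R) : compact D -> {within D, continuous u} ->
  tame D (fun x => (u x)%:C%C).
Proof.
move=> cD cu; split.
  apply: cmeasurable_real; apply: within_continuous_measurable_plane => //.
  exact: compact_measurable_plane.
have [C CP] := within_continuous_bounded cD cu.
by move=> r; exists C => x Dx _ _; rewrite normc_real; exact: CP.
Qed.

Lemma measurable_normcv D (g : R * R -> 'cV[R[i]]_2) :
  (forall i, cmeasurable D (fun x => g x i 0)) ->
  measurable_fun (D : set (plane (R := R))) (fun x => normcv (g x)).
Proof.
move=> mg; apply: (measurableT_comp (f := @Num.sqrt R)).
  by apply: measurable_realfun.continuous_measurable_fun; exact: sqrt_continuous.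
apply: measurable_sum => i.
by apply: measurable_realfun.measurable_funM; exact: cmeasurable_normc.
Qed.

End Tame.

(** * Complex integrals, essential suprema and the Cauchy-Schwarz inequality *)

Section Integrals.
Context {R : realType}.
Implicit Types (mu : {measure set (plane (R := R)) -> \bar R}).
Implicit Types (D : set (R * R)) (w : R * R -> R[i]) (g h k : R * R -> R).

Definition cintegrable mu D w : Prop :=
  mu.-integrable D (fun x => (complex.Re (w x))%:E) /\
  mu.-integrable D (fun x => (complex.Im (w x))%:E).

(** On a compact set local boundedness is boundedness, and bounded measurable functions are
    integrable for a finite measure. *)
Lemma tame_cintegrable mu D w :
  compact D -> (mu D < +oo)%E -> tame D w -> cintegrable mu D w.
Proof.
move=> cD muD [[mr mi] bw].
have [r rP] := compact_plane_bounded cD.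
have [C CP] := bw r.
have mD := compact_measurable_plane cD.
have bounded (u : R * R -> R) : (forall x, `|u x| <= Normc.normc (w x)) ->
    [bounded u x | x in D].
  move=> uw; exists C; split; first exact: num_real.
  move=> M CM x Dx; apply: (le_trans (uw x)); apply: le_trans (ltW CM).
  by have [x1 x2] := rP _ Dx; exact: CP.
split; apply: measurable_bounded_integrable => //; apply: bounded => x.
- exact: normrRe_le.
- exact: normrIm_le.
Qed.

Lemma cintegralB mu D w1 w2 : measurable (D : set (plane (R := R))) ->
  cintegrable mu D w1 -> cintegrable mu D w2 ->
  cintegral mu D w1 - cintegral mu D w2 = cintegral mu D (fun x => w1 x - w2 x).
Proof.
move=> mD [r1 i1] [r2 i2]; rewrite /cintegral.
by congr (_ +i* _)%C; rewrite -RintegralB//; apply: eq_Rintegral => x _;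
  case: (w1 x) (w2 x) => [? ?] [].
Qed.

Lemma cintegrable_normc mu D w : measurable (D : set (plane (R := R))) ->
  cmeasurable D w -> (\int[mu]_(x in D) (Normc.normc (w x))%:E < +oo)%E ->
  cintegrable mu D w.
Proof.
move=> mD [mr mi] wfin.
have mw := cmeasurable_normc (conj mr mi).
have iw : mu.-integrable D (fun x => (Normc.normc (w x))%:E).
  apply/integrableP; split; first exact/measurable_realfun.measurable_EFinP.
  by under eq_integral do rewrite gee0_abs ?lee_fin ?normc_ge0//.
split; apply: le_integrable iw => //.
- exact/measurable_realfun.measurable_EFinP.
- by move=> x _; rewrite lee_fin (ger0_norm (normc_ge0 _)) normrRe_le.
- exact/measurable_realfun.measurable_EFinP.
- by move=> x _; rewrite lee_fin (ger0_norm (normc_ge0 _)) normrIm_le.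
Qed.

(* With z the value of the integral, |z|^2 = \int Re (conj z * w) <= |z| \int |w|. *)
Lemma normc_cintegral_le mu D w : measurable (D : set (plane (R := R))) ->
  cmeasurable D w ->
  ((Normc.normc (cintegral mu D w))%:E <= \int[mu]_(x in D) (Normc.normc (w x))%:E)%E.
Proof.
move=> mD mw; set I := (X in (_ <= X)%E).
have I0 : (0 <= I)%E by apply: integral_ge0 => x _; rewrite lee_fin normc_ge0.
(* With an infinite right side nothing is to prove; otherwise [w] is integrable and real-valued
   integrals can be used. *)
have [Ioo|] := eqVneq I +oo%E; first by rewrite Ioo leey.
rewrite -ltey => Ifin; have [ir ii] := cintegrable_normc mD mw Ifin.
have iw : mu.-integrable D (EFin \o (fun x => Normc.normc (w x))).
  apply/integrableP; split.
    by apply/measurable_realfun.measurable_EFinP; exact: cmeasurable_normc.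
  by under eq_integral do rewrite gee0_abs ?lee_fin ?normc_ge0//.
set z := cintegral mu D w; set a := complex.Re z; set b := complex.Im z.
have IE : I = (\int[mu]_(x in D) Normc.normc (w x))%:E.
  by rewrite /Rintegral fineK// ge0_fin_numE.
rewrite IE lee_fin.
have [z0|z0] := eqVneq (Normc.normc z) 0.
  by rewrite z0; apply: Rintegral_ge0 => x _; exact: normc_ge0.
have zp : 0 < Normc.normc z by rewrite lt_neqAle eq_sym z0 normc_ge0.
rewrite -(ler_pM2l zp) -RintegralZl// -expr2 normc_sqrE !expr2 -/a -/b.
rewrite {2}/a {2}/b -!RintegralZl//.
have ia : mu.-integrable D (EFin \o (fun x => a * complex.Re (w x))).
  exact: (integrableZl mD a ir).
have ib : mu.-integrable D (EFin \o (fun x => b * complex.Im (w x))).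
  exact: (integrableZl mD b ii).
rewrite -RintegralD//. apply: le_Rintegral => //.
- exact: (integrableD mD ia ib).
- exact: (integrableZl mD (Normc.normc z) iw).
(* Pointwise, a Re w + b Im w is at most |z| |w|. *)
- move=> x _; apply: (le_trans (cauchy_schwarz2 _ _ _ _)).
  by rewrite /a /b; case: z (w x) {z0 zp a b ia ib} => [? ?] [].
Qed.

(** The norm of exponent [+oo] is the essential supremum of the modulus when the measure is nonzero;
    for the zero measure the whole plane serves as the exceptional null set. *)
Lemma ae_le_Lnormy mu (f : plane (R := R) -> \bar R) :
  \forall x \ae mu, (`|f x| <= Lnorm mu +oo f)%E.
Proof.
rewrite unlock; case: ifPn => [_|]; first exact: ess_sup_inf.ess_sup_ge.
rewrite -leNgt => mu0; exists setT; split => //.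
by apply/eqP; rewrite eq_le mu0 measure_ge0.
Qed.

Lemma hoelder2 mu g h :
  measurable_fun [set: plane (R := R)] g -> measurable_fun [set: plane (R := R)] h ->
  (forall x, 0 <= g x) -> (forall x, 0 <= h x) ->
  (\int[mu]_x (g x * h x)%:E <=
   Lnorm mu 2%:E (fun x => (g x)%:E) * Lnorm mu 2%:E (fun x => (h x)%:E))%E.
Proof.
move=> mg mh g0 h0.
have e2 : (2^-1 + 2^-1 = 1 :> R) by lra.
have := hoelder mu mg mh (ltr0n _ 2) (ltr0n _ 2) e2.
rewrite Lnorm1 => H; apply: le_trans H.
under [leRHS]eq_integral do rewrite /= ger0_norm ?mulr_ge0//.
by [].
Qed.

(** Takes the factor [g] out of the integral through its almost everywhere bound. [G] is an extended
    real because an essential supremum may be infinite. *)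
Lemma ge0_le_integral_ae_bound mu D g h (G : \bar R) w :
  measurable (D : set (plane (R := R))) -> cmeasurable D w ->
  measurable_fun (D : set (plane (R := R))) h -> (forall x, D x -> 0 <= h x) ->
  (0 <= G)%E ->
  (\forall x \ae mu, D x -> ((`|g x|)%:E <= G)%E) ->
  (forall x, D x -> Normc.normc (w x) <= g x * h x) ->
  (\int[mu]_(x in D) (Normc.normc (w x))%:E <= G * \int[mu]_(x in D) (h x)%:E)%E.
Proof.
move=> mD mw mh h0 G0 gG wgh.
have mhE := (measurable_realfun.measurable_EFinP _ _).2 mh.
rewrite -ge0_integralZl//; apply: ae_ge0_le_integral => //.
- by move=> x _; rewrite lee_fin normc_ge0.
- by apply/measurable_realfun.measurable_EFinP; exact: cmeasurable_normc.
- by move=> x Dx; rewrite mule_ge0// lee_fin h0.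
- exact: measurable_funeM.
- apply: (@filterS _ _ (ae_filter_ringOfSetsType mu)) gG => x gG Dx.
  apply: (@le_trans _ _ ((`|g x|)%:E * (h x)%:E)%E).
    rewrite -EFinM lee_fin; apply: (le_trans (wgh _ Dx)).
    by rewrite ler_wpM2r ?h0// ler_norm.
  by apply: lee_wpmul2r; [rewrite lee_fin h0|exact: gG].
Qed.

(** Multiplying by the indicator of [D] is the same as restricting to [D] with value 0 outside, so
    the inequality on the whole plane applies to the extended functions. *)
Lemma norm_on_hoelder D h k : measurable (D : set (plane (R := R))) ->
  measurable_fun (D : set (plane (R := R))) h ->
  measurable_fun (D : set (plane (R := R))) k ->
  (forall x, 0 <= h x) -> (forall x, 0 <= k x) ->
  (\int[area]_(x in D) (h x * k x)%:E <= norm_on 2%:E D h * norm_on 2%:E D k)%E.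
Proof.
move=> mD mh mk h0 k0.
have restrictE (u : R * R -> R) : (fun x => u x * \1_D x) = u \_ D.
  by apply/funext => x; rewrite patchE indicE; case: ifP; rewrite ?mulr1 ?mulr0.
have mr (u : R * R -> R) : measurable_fun (D : set (plane (R := R))) u ->
    measurable_fun [set: plane (R := R)] (fun x => u x * \1_D x).
  by move=> mu; rewrite restrictE; apply/(measurable_restrictT _ mD).
have r0 (u : R * R -> R) x : (forall x, 0 <= u x) -> 0 <= u x * \1_D x.
  by move=> u0; rewrite mulr_ge0 ?u0// indicE.
apply: le_trans (hoelder2 _ (mr _ mh) (mr _ mk) _ _); [|by move=> x; exact: r0..].
rewrite integral_mkcond le_eqVlt; apply/orP; left; apply/eqP.
apply: eq_integral => x _; rewrite patchE indicE; case: ifP => _ //=.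
- by rewrite !mulr1.
- by rewrite !mulr0.
Qed.

Lemma norm_on_ae_bound D g :
  \forall x \ae (area : {measure set (plane (R := R)) -> \bar R}),
    D x -> ((`|g x|)%:E <= norm_on +oo D g)%E.
Proof.
have := ae_le_Lnormy area (fun x => (g x * \1_D x)%:E).
apply: filterS => x /= + Dx.
by rewrite indicE mem_set// mulr1.
Qed.

End Integrals.

(** * Perturbation of the diffusion, boundary and reaction terms on one triangle *)

Section Consistency.
Context {R : realType}.
Implicit Types (K : triangle R) (B : R * R -> 'M[R]_2) (beta : R * R -> R).

(** The step shared by the three terms: [g] is the size of the coefficient difference, [G] its
    essential supremum, and [h] the product of the moduli of trial and test quantities. *)
Lemma cintegral_diff_le (mu : {measure set (plane (R := R)) -> \bar R})
    (D : set (R * R)) (w1 w2 : R * R -> R[i]) (g h : R * R -> R) (G : \bar R) :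
  compact D -> (mu D < +oo)%E -> tame D w1 -> tame D w2 ->
  measurable_fun (D : set (plane (R := R))) h -> (forall x, 0 <= h x) ->
  (0 <= G)%E -> (\forall x \ae mu, D x -> ((`|g x|)%:E <= G)%E) ->
  (forall x, D x -> Normc.normc (w1 x - w2 x) <= g x * h x) ->
  ((Normc.normc (cintegral mu D w1 - cintegral mu D w2))%:E
     <= G * \int[mu]_(x in D) (h x)%:E)%E.
Proof.
move=> cD muD t1 t2 mh h0 G0 gG wgh.
have mD := compact_measurable_plane cD.
rewrite cintegralB//; [|exact: tame_cintegrable..].
have [m12 _] : tame D (fun x => w1 x - w2 x).
  by apply: eq_tame (tameD t1 (tameM (tame_cst D (-1)) t2)) => x _; rewrite mulN1r.
apply: (le_trans (normc_cintegral_le mu mD m12)).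
exact: ge0_le_integral_ae_bound wgh.
Qed.

Lemma tame_mulmx D B (z : R * R -> 'cV[R[i]]_2) i :
  (forall i j, tame D (fun x => (B x i j)%:C%C)) ->
  (forall i, tame D (fun x => z x i 0)) ->
  tame D (fun x => (cmx (B x) *m z x) i 0).
Proof.
move=> tB tz.
apply: (@eq_tame _ _ (fun x => \sum_j (B x i j)%:C%C * z x j 0)) => [x _|].
  by rewrite mxE; apply: eq_bigr => j _; rewrite mxE.
by apply: tame_sum => j; exact: tameM.
Qed.

Lemma tame_flux D K i (z : R * R -> 'cV[R[i]]_2) :
  (forall i, tame D (fun x => z x i 0)) -> tame D (fun x => flux K i (z x)).
Proof.
by move=> tz; apply: tameD; (apply: tameM; first exact: tame_cst); exact: tz.
Qed.

Lemma measurable_normcv_gradc D (q : mpoly 2 R[i]) :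
  measurable_fun (D : set (plane (R := R))) (fun x => normcv (gradc q x)).
Proof. by apply: measurable_normcv => i; case: (tame_gradc D q i 0). Qed.

Lemma measurable_normc_evalc D (q : mpoly 2 R[i]) :
  measurable_fun (D : set (plane (R := R))) (fun x => Normc.normc (evalc q x)).
Proof. by apply: cmeasurable_normc; case: (tame_evalc D q). Qed.

Lemma normcv_ge0 (z : 'cV[R[i]]_2) : 0 <= normcv z.
Proof. exact: sqrtr_ge0. Qed.

Lemma cmxB_mulmx (M N : 'M[R]_2) (z : 'cV[R[i]]_2) :
  cmx M *m z - cmx N *m z = cmx (M - N) *m z.
Proof. by rewrite -mulmxBl -map_mxB. Qed.

Lemma diffusion_diff_le K B B' (v : R * R -> R[i]) (q : mpoly 2 R[i]) :
  (forall i j, tame (triangle_set K) (fun x => (B x i j)%:C%C)) ->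
  (forall i j, tame (triangle_set K) (fun x => (B' x i j)%:C%C)) ->
  ((Normc.normc
      (inner_prodv area (triangle_set K) (fun x => cmx (B x) *m gradK K v x) (gradc q)
       - inner_prodv area (triangle_set K) (fun x => cmx (B' x) *m gradK K v x) (gradc q)))%:E
   <= norm_on +oo (triangle_set K) (fun x => spectral_norm (B x - B' x)%R)
      * norm_on 2%:E (triangle_set K) (fun x => normcv (gradK K v x))
      * norm_on 2%:E (triangle_set K) (fun x => normcv (gradc q x)))%E.
Proof.
move=> tB tB'; set D := triangle_set K; set G := norm_on _ _ _.
have cD : compact D by exact: face_compact.
have mD := compact_measurable_plane cD.
(* [gradK K v] is by definition [gradc] of the polynomial [piece K v], so this covers both
   gradients. *)
have tgrad p' i : tame D (fun x => gradc p' x i 0) by exact: tame_gradc.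
have tw B0 : (forall i j, tame D (fun x => (B0 x i j)%:C%C)) ->
    tame D (fun x => \sum_i (cmx (B0 x) *m gradK K v x) i 0 * conjc (gradc q x i 0)).
  move=> tB0; apply: tame_sum => i; apply: tameM; last exact/tame_conj.
  by apply: tame_mulmx => // j; exact: tgrad.
(* Cauchy-Schwarz for the two gradients is split off first; what remains is to take out [G]. *)
rewrite -muleA; apply: le_trans (_ : (G * \int[area]_(x in D)
    (normcv (gradK K v x) * normcv (gradc q x))%:E)%E <= _)%E; last first.
  apply: lee_wpmul2l; first exact: Lnorm_ge0.
  apply: norm_on_hoelder => //; [exact: measurable_normcv_gradc..| |];
    by move=> x; exact: normcv_ge0.
apply: cintegral_diff_le (tw _ tB) (tw _ tB') _ _ _ (norm_on_ae_bound _ _) _ => //.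
- exact: area_compact_lty.
- by apply: measurable_realfun.measurable_funM; exact: measurable_normcv_gradc.
- by move=> x; rewrite mulr_ge0 ?normcv_ge0.
- exact: Lnorm_ge0.
move=> x _; rewrite -sumrB.
under eq_bigr do rewrite -mulrBl.
have -> : \sum_i ((cmx (B x) *m gradK K v x) i 0 - (cmx (B' x) *m gradK K v x) i 0)
    * conjc (gradc q x i 0) =
    \sum_i (cmx (B x - B' x) *m gradK K v x) i 0 * conjc (gradc q x i 0).
  by apply: eq_bigr => i _; rewrite -cmxB_mulmx !mxE.
apply: (le_trans (normc_inner_le _ _)); rewrite mulrA.
by rewrite ler_wpM2r ?normcv_ge0// normcv_mul_le_spectral.
Qed.

(** The boundary measure is the sum of the edge measures, so its null sets are null for each of
    them. This lets the essential supremum over the whole boundary be used on a single edge. *)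
Lemma ae_edge_measure K i (P : set (R * R)) :
  (\forall x \ae boundary_measure K, P x) -> \forall x \ae edge_measure K i, P x.
Proof.
move=> [N [mN N0 PN]]; exists N; split => //.
have : (\sum_(k < 3) edge_measure K (inord k) N = 0)%E by exact: N0.
move/eqP; rewrite seq_psume_eq0 => [|k _]; last exact: measure_ge0.
by move=> /allP/(_ i); rewrite mem_index_enum inord_val => /(_ isT)/eqP.
Qed.

(** Gives the inclusion of edges in the closed triangle, through which tame coefficients on the
    triangle have tame traces. *)
Lemma face_subset K (I J : {set 'I_3}) : I \subset J -> face K I `<=` face K J.
Proof.
move=> IJ x [l [l0 lI l1 x1 x2]]; exists l; split => // i iJ; apply: lI.
by apply: contra iJ; apply: (fintype.subsetP IJ).
Qed.

(** Each edge is bounded with the same constant [G]; adding the edge integrals gives one integral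
    for [boundary_measure K], to which Cauchy-Schwarz is applied once. *)
Lemma boundary_diff_le K B B' (v : R * R -> R[i]) (q : mpoly 2 R[i]) :
  (forall i j, tame (triangle_set K) (fun x => (B x i j)%:C%C)) ->
  (forall i j, tame (triangle_set K) (fun x => (B' x i j)%:C%C)) ->
  ((Normc.normc
      (\sum_i inner_prod (edge_measure K i) (edge K i)
         (fun x => flux K i (cmx (B x) *m gradK K v x)) (evalc q)
       - \sum_i inner_prod (edge_measure K i) (edge K i)
         (fun x => flux K i (cmx (B' x) *m gradK K v x)) (evalc q)))%:E
   <= norm_boundary +oo K (fun x => spectral_norm (B x - B' x)%R)
      * norm_boundary 2%:E K (fun x => normcv (gradK K v x))
      * norm_boundary 2%:E K (fun x => Normc.normc (evalc q x)))%E.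
Proof.
move=> tB tB'; set G := norm_boundary +oo _ _.
pose h x := normcv (gradK K v x) * Normc.normc (evalc q x).
have h0 x : 0 <= h x by rewrite mulr_ge0 ?normcv_ge0 ?normc_ge0.
have mh D : measurable_fun (D : set (plane (R := R))) h.
  by apply: measurable_realfun.measurable_funM; [exact: measurable_normcv_gradc|exact: measurable_normc_evalc].
have G0 : (0 <= G)%E by exact: Lnorm_ge0.
have edge_le i : ((Normc.normc
    (inner_prod (edge_measure K i) (edge K i)
       (fun x => flux K i (cmx (B x) *m gradK K v x)) (evalc q)
     - inner_prod (edge_measure K i) (edge K i)
       (fun x => flux K i (cmx (B' x) *m gradK K v x)) (evalc q)))%:E
    <= G * \int[edge_measure K i]_x (h x)%:E)%E.
  set D := edge K i.
  have cD : compact D by exact: face_compact.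
  have mD := compact_measurable_plane cD.
  have DK : D `<=` triangle_set K by apply: face_subset; exact: finset.subsetT.
  have tw B0 : (forall i j, tame (triangle_set K) (fun x => (B0 x i j)%:C%C)) ->
      tame D (fun x => flux K i (cmx (B0 x) *m gradK K v x) * conjc (evalc q x)).
    move=> tB0; apply: tameM; last exact/tame_conj/tame_evalc.
    apply: tame_flux => j; apply: tame_mulmx => [k l|k]; last exact: tame_gradc.
    by apply: tame_subset DK _ (tB0 k l); exact: face_measurable.
  (* [norm_boundary] integrates over the whole plane, so the nonnegative integral over the edge is
     enlarged accordingly. *)
  apply: (@le_trans _ _ (G * \int[edge_measure K i]_(x in D) (h x)%:E)%E); last first.
    apply: lee_wpmul2l => //; apply: ge0_subset_integral => //.
    - by apply/measurable_realfun.measurable_EFinP; exact: mh.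
    - by move=> x _; rewrite lee_fin.
  apply: (cintegral_diff_le (g := fun x => spectral_norm (B x - B' x))
    cD _ (tw _ tB) (tw _ tB') (mh D) h0 G0).
  - exact: edge_measure_lty.
  - apply: ae_edge_measure.
    have := ae_le_Lnormy (boundary_measure K) (fun x => (spectral_norm (B x - B' x))%:E).
    by apply: (@filterS _ _ (ae_filter_ringOfSetsType (boundary_measure K))) => x /= + _.
  - move=> x _; rewrite -mulrBl Normc.normcM normc_conj /h mulrA.
    rewrite ler_wpM2r ?normc_ge0//.
    (* The flux is linear, so the difference of fluxes is the flux of the difference matrix, and the
       normal does not enlarge the modulus. *)
    have -> : flux K i (cmx (B x) *m gradK K v x) - flux K i (cmx (B' x) *m gradK K v x) =
        flux K i (cmx (B x - B' x) *m gradK K v x).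
      rewrite -cmxB_mulmx /flux; set z := cmx _ *m _; set z' := cmx _ *m _.
      by rewrite [(z - z') 0 0]mxE [(z - z') 1 0]mxE ![(- z') _ _]mxE; ring.
    by apply: (le_trans (normc_flux_le _ _ _)); exact: normcv_mul_le_spectral.
rewrite -sumrB; apply: (@le_trans _ _ (\sum_i G * \int[edge_measure K i]_x (h x)%:E)%E).
  apply: (@le_trans _ _ (\sum_i (Normc.normc (_ : R[i]))%:E)%E); last first.
    by apply: lee_sum => i _; exact: edge_le.
  by rewrite sumEFin lee_fin normc_sum_le.
rewrite -ge0_sume_distrr; last by move=> i _; apply: integral_ge0 => x _; rewrite lee_fin.
rewrite -muleA lee_wpmul2l//.
have -> : (\sum_i \int[edge_measure K i]_x (h x)%:E =
    \int[boundary_measure K]_x (h x)%:E)%E.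
  rewrite /boundary_measure ge0_integral_measure_sum//.
  - by apply: eq_bigr => i _; rewrite inord_val.
  - by move=> x _; rewrite lee_fin.
  - by apply/measurable_realfun.measurable_EFinP; exact: mh.
apply: hoelder2.
- exact: measurable_normcv_gradc.
- exact: measurable_normc_evalc.
- by move=> x; exact: normcv_ge0.
- by move=> x; exact: normc_ge0.
Qed.

Lemma reaction_diff_le K beta beta' (v : R * R -> R[i]) (q : mpoly 2 R[i]) :
  tame (triangle_set K) (fun x => (beta x)%:C%C) ->
  tame (triangle_set K) (fun x => (beta' x)%:C%C) ->
  tame (triangle_set K) v ->
  ((Normc.normc
      (inner_prod area (triangle_set K) (fun x => (beta x)%:C%C * v x) (evalc q)
       - inner_prod area (triangle_set K) (fun x => (beta' x)%:C%C * v x) (evalc q)))%:E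
   <= norm_on +oo (triangle_set K) (fun x => `|beta x - beta' x|%R)
      * norm_on 2%:E (triangle_set K) (fun x => Normc.normc (v x))
      * norm_on 2%:E (triangle_set K) (fun x => Normc.normc (evalc q x)))%E.
Proof.
move=> tb tb' tv; set D := triangle_set K; set G := norm_on _ _ _.
have cD : compact D by exact: face_compact.
have mD := compact_measurable_plane cD.
have tw b : tame D (fun x => (b x)%:C%C) ->
    tame D (fun x => (b x)%:C%C * v x * conjc (evalc q x)).
  by move=> tb0; apply: tameM; [exact: tameM|exact/tame_conj/tame_evalc].
have mv : measurable_fun (D : set (plane (R := R))) (fun x => Normc.normc (v x)).
  by apply: cmeasurable_normc; case: tv.
rewrite -muleA; apply: le_trans (_ : (G * \int[area]_(x in D)
    (Normc.normc (v x) * Normc.normc (evalc q x))%:E)%E <= _)%E; last first.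
  apply: lee_wpmul2l; first exact: Lnorm_ge0.
  apply: norm_on_hoelder => //; [|by move=> x; exact: normc_ge0..].
  exact: measurable_normc_evalc.
apply: cintegral_diff_le (tw _ tb) (tw _ tb') _ _ _ (norm_on_ae_bound _ _) _ => //.
- exact: area_compact_lty.
- by apply: measurable_realfun.measurable_funM => //; exact: measurable_normc_evalc.
- by move=> x; rewrite mulr_ge0 ?normc_ge0.
- exact: Lnorm_ge0.
move=> x _; rewrite -mulrBl -mulrBl -rmorphB /= !Normc.normcM normc_conj normc_real.
by rewrite mulrA.
Qed.

End Consistency.

(** * Broken polynomials on the patch and the source moment *)

Section BrokenFunctions.
Context {R : realType}.
Implicit Types (T : triangulation R) (D : set (R * R)).

Lemma tame_broken_fun T D (psi : broken_poly T) : tame D (broken_fun psi).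
Proof.
(* [F S] is the set of points whose containing triangles are exactly those of
   [S]; on it [broken_fun psi] is a single polynomial. *)
pose F (S : {set 'I_(ntri T)}) : set (R * R) :=
  \bigcap_(K in [set: 'I_(ntri T)])
    (if K \in S then triangle_set (T K) else ~` triangle_set (T K)).
have mF S : measurable (F S : set (plane (R := R))).
  apply: fin_bigcap_measurable => // K _.
  by case: ifP => _; [|apply: measurableC]; exact: face_measurable.
have FE S x : F S x <-> S = [set K | `[< triangle_set (T K) x >]]%SET.
  split=> [FSx|-> K _]; last by rewrite finset.inE; case: asboolP.
  by apply/finset.setP => K; have := FSx K I; rewrite finset.inE;
    case: ifP => _ TKx; apply/esym; [apply/asboolP|apply/asboolPn].
apply: (@eq_tame _ _ (fun x => \sum_S (\1_(F S) x)%:C%C *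
    if [pick K in S] is Some K then evalc (psi K) x else 0)) => [x _|].
  (* Exactly one [S] contributes at [x], the set of all triangles containing [x], and picking from
     it agrees with the choice in [broken_fun]. *)
  rewrite (bigD1 [set K | `[< triangle_set (T K) x >]]%SET)//= big1 => [|S Sx].
    rewrite addr0 indicE mem_set; last exact/FE.
    by rewrite mul1r /broken_fun; under eq_pick do rewrite finset.inE.
  rewrite indicE memNset ?mul0r// => /FE SE.
  by move/eqP: Sx.
apply: tame_sum => S; apply: tameM.
  split; first by apply: cmeasurable_real; exact: measurable_realfun.measurable_indic.
  by move=> r; exists 1 => x _ _ _; rewrite normc_real indicE; case: (_ \in _);
    rewrite ?normr1 ?normr0 ?ler01.
by case: pickP => [K _|_]; [exact: tame_evalc|exact: tame_cst].
Qed.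

Lemma source_moment_le T (f : R * R -> R[i]) (fm psi : broken_poly T) :
  cmeasurable (patch_set T) f ->
  ((Normc.normc
      (inner_prod area (patch_set T) (fun x => f x - broken_fun fm x) (broken_fun psi)))%:E
   <= \sum_(K < ntri T)
        (norm_on 2%:E (triangle_set (T K))
           (fun x => Normc.normc (f x - evalc (fm K) x)%R)
         * norm_on 2%:E (triangle_set (T K))
             (fun x => Normc.normc (evalc (psi K) x))))%E.
Proof.
move=> mf; set D := patch_set T.
have mD : measurable (D : set (plane (R := R))) by exact: patch_measurable.
have mT K : measurable (triangle_set (T K) : set (plane (R := R))).
  exact: face_measurable.
have TD K : triangle_set (T K) `<=` D by move=> x TKx; exists K.
have mB g : tame D g -> cmeasurable D (fun x => f x - g x).
  move=> [mg _]; apply: eq_cmeasurable (cmeasurableD mf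
    (cmeasurableM (cmeasurable_cst D (-1)) mg)) => x _.
  by rewrite mulN1r.
pose u K x : R := Normc.normc (f x - evalc (fm K) x) * Normc.normc (evalc (psi K) x).
have u0 K x : 0 <= u K x by rewrite mulr_ge0 ?normc_ge0.
have mu K : measurable_fun (D : set (plane (R := R))) (u K).
  apply: measurable_realfun.measurable_funM; last exact: measurable_normc_evalc.
  by apply: cmeasurable_normc; apply: mB; exact: tame_evalc.
have mw : cmeasurable D (fun x => (f x - broken_fun fm x) * conjc (broken_fun psi x)).
  apply: cmeasurableM; first by apply: mB; exact: tame_broken_fun.
  by case: (tame_conj (tame_broken_fun D psi)).
apply: (le_trans (normc_cintegral_le area mD mw)).
have mu1 K : measurable_fun (D : set (plane (R := R)))
    (fun x => u K x * \1_(triangle_set (T K)) x).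
  exact: (measurable_realfun.measurable_funM (mu K)
    (measurable_realfun.measurable_indic (mT K))).
have mu1E K := (measurable_realfun.measurable_EFinP _ _).2 (mu1 K).
have u10 K x : (0 <= (u K x * \1_(triangle_set (T K)) x)%:E)%E.
  by rewrite lee_fin mulr_ge0// indicE.
apply: (@le_trans _ _ (\int[area]_(x in D)
    \sum_(K < ntri T) (u K x * \1_(triangle_set (T K)) x)%:E)%E).
  apply: ge0_le_integral => //.
  - by move=> x _; rewrite lee_fin normc_ge0.
  - by apply/measurable_realfun.measurable_EFinP; exact: cmeasurable_normc.
  - by apply: emeasurable_sum => K; exact: mu1E.
  (* Both broken functions pick the same triangle at [x]; its term equals the integrand's modulus
     and the other terms are nonnegative. *)
  - move=> x [K0 TK0]; rewrite sumEFin lee_fin /broken_fun.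
    case: pickP => [K /asboolP TKx|/(_ K0)/asboolP//].
    rewrite (bigD1 K)//= indicE mem_set// mulr1 Normc.normcM normc_conj lerDl.
    by apply: sumr_ge0 => j _; rewrite -lee_fin; exact: u10.
rewrite ge0_integral_sum//; apply: lee_sum => K _.
apply: le_trans (norm_on_hoelder _ _ _ _ _) => //.
(* The indicator turns the integral over the patch into one over the triangle, which lies in the
   patch. *)
- rewrite integral_mkcond [leRHS]integral_mkcond le_eqVlt; apply/orP; left; apply/eqP.
  apply: eq_integral => x _; rewrite !patchE indicE.
  have [TKx|TKx] := boolP (x \in triangle_set (T K)).
    by rewrite mulr1 ifT//; apply: mem_set; apply: (TD K); exact: set_mem.
  by rewrite mulr0; case: ifP.
- apply: measurable_funS (TD K) _ => //.
  by apply: cmeasurable_normc; apply: mB; exact: tame_evalc.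
- exact: measurable_normc_evalc.
- by move=> x; exact: normc_ge0.
- by move=> x; exact: normc_ge0.
Qed.

End BrokenFunctions.

(** * Assembly of the three terms and summation over the triangles *)

Lemma normc_sum_lee (R : realType) (n : nat) (z : 'I_n -> R[i]) (e : 'I_n -> \bar R) :
  (forall k, (Normc.normc (z k))%:E <= e k)%E ->
  ((Normc.normc (\sum_k z k))%:E <= \sum_k e k)%E.
Proof.
move=> ze; apply: (@le_trans _ _ (\sum_k (Normc.normc (z k))%:E)%E).
  by rewrite sumEFin lee_fin normc_sum_le.
by apply: lee_sum => k _; exact: ze.
Qed.

(** Regrouping by linearity pairs each term with its perturbed counterpart; [k] stands for the
    square of [kappa]. *)
Lemma normc_three_terms_le (R : realType) (a a' b b' c c' : R[i]) (k : R)
    (ea eb ec : \bar R) :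
  0 <= k ->
  ((Normc.normc (a - a'))%:E <= ea)%E -> ((Normc.normc (b - b'))%:E <= eb)%E ->
  ((Normc.normc (c - c'))%:E <= ec)%E ->
  ((Normc.normc (a - b - k%:C%C * c - (a' - b' - k%:C%C * c')))%:E
     <= ea + eb + k%:E * ec)%E.
Proof.
move=> k0 aea beb cec.
have -> : a - b - k%:C%C * c - (a' - b' - k%:C%C * c') =
  (a - a') - (b - b') - k%:C%C * (c - c') by ring.
apply: (@le_trans _ _ ((Normc.normc (a - a'))%:E + (Normc.normc (b - b'))%:E +
    k%:E * (Normc.normc (c - c'))%:E)%E).
  rewrite -EFinM -!EFinD lee_fin; apply: (le_trans (normcB_le _ _)).
  by rewrite Normc.normcM normc_real ger0_norm// lerD2r normcB_le.
by apply: leeD; [exact: leeD|rewrite lee_wpmul2l// lee_fin].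
Qed.

Theorem proposition3p3 (R : realType) (T : triangulation R) (p : nat)
  (hp : (2 <= p)%N) (kappa eta0 : R) (hkappa : 0 < kappa) (heta0 : 0 < eta0)
  (A : R * R -> 'M[R]_2) (eta : R * R -> R) (f : R * R -> R[i])
  (A_smooth : forall i j, smooth (patch_set T) (fun x => A x i j))
  (A_sym : forall x, patch_set T x -> (A x)^T = A x)
  (A_posdef : uniformly_posdef (patch_set T) A)
  (eta_smooth : smooth (patch_set T) eta)
  (eta_ge : forall x, patch_set T x -> eta0 <= eta x)
  (f_L2 : square_integrable (patch_set T) f)
  (Am : 'I_(ntri T) -> 'M[rpoly R]_2) (etam : 'I_(ntri T) -> rpoly R)
  (fm : broken_poly T) :
  (forall (v : R * R -> R[i]) (psi : broken_poly T),
     S1space T p v -> Yspace (p - 2) psi ->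
     ((Normc.normc
        (residual kappa (fun _ => A) (fun _ => eta) v psi
         - residual kappa (fun K => evalr_mx (Am K)) (fun K => evalr (etam K)) v psi))%:E
      <= consistency_bound kappa (fun _ => A) (fun K => evalr_mx (Am K))
           (fun _ => eta) (fun K => evalr (etam K)) v psi)%E) /\
  (forall psi : broken_poly T, Yspace (p - 2) psi ->
     ((Normc.normc
         (inner_prod area (patch_set T) (fun x => f x - broken_fun fm x) (broken_fun psi)))%:E
      <= \sum_(K < ntri T)
           (norm_on 2%:E (triangle_set (T K))
              (fun x => Normc.normc (f x - evalc (fm K) x)%R)
            * norm_on 2%:E (triangle_set (T K))
                (fun x => Normc.normc (evalc (psi K) x))))%E).
Proof.
have tri_patch K : triangle_set (T K) `<=` patch_set T by move=> x TKx; exists K.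
have tame_smooth K (u : R * R -> R) : smooth (patch_set T) u ->
    tame (triangle_set (T K)) (fun x => (u x)%:C%C).
  (* The case k = 0 of smoothness is continuity on the patch, which restricts to each compact
     triangle. *)
  move=> /(_ 0%N)[cu _]; apply: tame_continuous; first exact: face_compact.
  exact: continuous_subspaceW cu.
split; last by move=> psi _; apply: source_moment_le; case: f_L2.
move=> v psi [_ _ v_poly] _.
rewrite /residual /consistency_bound -sumrB; apply: normc_sum_lee => K.
have tA i j : tame (triangle_set (T K)) (fun x => (A x i j)%:C%C).
  exact: tame_smooth.
have tAm i j : tame (triangle_set (T K)) (fun x => (evalr_mx (Am K) x i j)%:C%C).
  by apply: eq_tame (tame_evalr _ (Am K i j)) => x _; rewrite mxE.
have tv : tame (triangle_set (T K)) v.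
  (* On the triangle [v] coincides with a polynomial. *)
  by have [q _ vq] := v_poly K; apply: eq_tame (tame_evalc _ q) => x /vq.
have diffusion := diffusion_diff_le v (psi K) tA tAm.
have boundary := boundary_diff_le v (psi K) tA tAm.
have reaction := reaction_diff_le (psi K) (tame_smooth K _ eta_smooth)
  (tame_evalr _ (etam K)) tv.
apply: le_trans (normc_three_terms_le (sqr_ge0 kappa) diffusion boundary reaction) _.
by rewrite !muleA.
Qed.
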